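(* Fix an integer $k\ge 2$ and distinct integers $t_1,\dots,t_{k-1}\ge 2$. Let $M=\max\{1,t_1,\dots,t_{k-1}\}$, let $Q=\max_{a,b\in\{1,t_1,\dots,t_{k-1}\}}(ab+M)$, and let $p>Q$ be a prime. Let $T=\{\pm1,\pm t_1,\dots,\pm t_{k-1}\}\subset\mathbb{Z}_p$, and let $S=\{r^{\pm1},r^{\pm t_1},\dots,r^{\pm t_{k-1}}\}$ be a set of distinct, non-identity rotations in $D_{2p}$. Then $$\mathrm{Aut}\bigl(\mathrm{Cay}(D_{2p},S)\bigr)\cong\bigl(R(\mathbb{Z}_p)\rtimes H\bigr)\wr\mathbb{Z}_2,$$ where $H=\langle p-1\rangle=\{1,p-1\}\subset\mathbb{Z}_p^\times$.
   Context: $D_{2p}=\langle r,s\mid r^p=e,\ s^2=e,\ srs=r^{-1}\rangle$ is the dihedral group of order $2p$; its rotations are the elements $r^i$. For a group $G$ and an inverse-closed subset $S\subseteq G\setminus\{e\}$, the undirected Cayley graph $\mathrm{Cay}(G,S)$ has vertex set $G$, with $u,v$ adjacent if and only if $uv^{-1}\in S$; $\mathrm{Aut}$ denotes its graph automorphism group. $R(\mathbb{Z}_p)=\{x\mapsto x+a: a\in\mathbb{Z}_p\}$ is the right regular representation (translations) of $\mathbb{Z}_p$, and a subgroup $H\le\mathbb{Z}_p^\times\cong\mathrm{Aut}(\mathbb{Z}_p)$ acts on $\mathbb{Z}_p$ by multiplication $x\mapsto hx$; $R(\mathbb{Z}_p)\rtimes H$ is the corresponding semidirect product, i.e. the group of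 maps $x\mapsto hx+a$ with $h\in H$, $a\in\mathbb{Z}_p$. For a group $A$, $A\wr\mathbb{Z}_2=(A\times A)\rtimes\mathbb{Z}_2$ is the wreath product, with $\mathbb{Z}_2$ swapping the two factors. *)

(* Defs.v *)
From mathcomp Require Import all_boot all_algebra all_fingroup all_solvable.

Set Implicit Arguments.
Unset Strict Implicit.
Unset Printing Implicit Defensive.

Import GRing.Theory GroupScope.

Section Graph.

Variables (V : finType) (e : rel V).

Definition graph_aut : {set {perm V}} :=
  [set f : {perm V} | [forall u, forall v, e (f u) (f v) == e u v]].

Lemma graph_autP (f : {perm V}) :
  reflect (forall u v, e (f u) (f v) = e u v) (f \in graph_aut).
Proof.
rewrite inE; apply: (iffP forallP) => [H u v | H u].
  by move/forallP: (H u) => /(_ v)/eqP.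
by apply/forallP => v; rewrite H.
Qed.

Lemma graph_aut_group_set : group_set graph_aut.
Proof.
apply/group_setP; split=> [|f g /graph_autP Hf /graph_autP Hg].
  by apply/graph_autP => u v; rewrite !perm1.
by apply/graph_autP => u v; rewrite !permM Hg Hf.
Qed.

Canonical graph_aut_group := Group graph_aut_group_set.

End Graph.

Definition cayley (gT : finGroupType) (S : {set gT}) : rel gT :=
  fun u v => u * v^-1 \in S.

Definition pm_powers (gT : finGroupType) (r : gT) (ts : seq nat) : {set gT} :=
  [set x in [seq r ^+ a | a <- ts] ++ [seq r ^- a | a <- ts]].

Definition one_and (n : nat) (t : 'I_n -> nat) : seq nat :=
  1%N :: [seq t i | i : 'I_n].

Definition maxM (ts : seq nat) : nat := \max_(a <- ts) a.

Definition maxQ (ts : seq nat) : nat :=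
  \max_(a <- ts) \max_(b <- ts) (a * b + maxM ts)%N.

Section Affine.

Variable p : nat.

Lemma translation_inj (a : 'Z_p) : injective (fun x : 'Z_p => (x + a)%R).
Proof. exact: addIr. Qed.

Definition translation (a : 'Z_p) : {perm 'Z_p} := perm (@translation_inj a).

Lemma dilation_inj (h : {unit 'Z_p}) :
  injective (fun x : 'Z_p => (val h * x)%R).
Proof. by apply: mulrI; exact: valP h. Qed.

Definition dilation (h : {unit 'Z_p}) : {perm 'Z_p} := perm (@dilation_inj h).

Lemma translationD : {morph translation : a b / (a + b)%R >-> a * b}.
Proof. by move=> a b; apply/permP=> x; rewrite permM !permE addrA. Qed.

Lemma dilationM : {morph dilation : g h / g * h}.
Proof.
move=> g h; apply/permP=> x; rewrite permM !permE /= mulrA.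
by congr (_ * _)%R; rewrite mulrC.
Qed.

Definition translations : {set {perm 'Z_p}} := [set translation a | a : 'Z_p].

Lemma translations_group_set : group_set translations.
Proof.
apply/group_setP; split=> [|_ _ /imsetP[a _ ->] /imsetP[b _ ->]].
  by apply/imsetP; exists 0%R => //; apply/permP=> x; rewrite perm1 permE addr0.
by rewrite -translationD imset_f.
Qed.

Canonical translations_group := Group translations_group_set.

Definition dilations (H : {set {unit 'Z_p}}) : {set {perm 'Z_p}} :=
  [set dilation h | h in H].

Lemma dilations_group_set (H : {group {unit 'Z_p}}) : group_set (dilations H).
Proof.
apply/group_setP; split=> [|_ _ /imsetP[g Hg ->] /imsetP[h Hh ->]].
  apply/imsetP; exists 1 => //; apply/permP=> x.
  by rewrite perm1 permE /= mul1r.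
by rewrite -dilationM imset_f // groupM.
Qed.

Canonical dilations_group H := Group (@dilations_group_set H).

(* Permutations compose from left to right, so that [dilation h * translation a]
   is the map x |-> h x + a. *)
Definition affine (H : {set {unit 'Z_p}}) : {set {perm 'Z_p}} :=
  [set dilation h * translation a | h : {unit 'Z_p} in H, a : 'Z_p].

Lemma affineE (h : {unit 'Z_p}) (a x : 'Z_p) :
  (dilation h * translation a) x = (val h * x + a)%R.
Proof. by rewrite permM !permE. Qed.

Lemma affine_group_set (H : {group {unit 'Z_p}}) : group_set (affine H).
Proof.
apply/group_setP; split=> [|_ _ /imset2P[g a Hg _ ->] /imset2P[h b Hh _ ->]].
  suff -> : 1 = dilation 1 * translation 0%R by apply: imset2_f; rewrite ?groupM ?inE.
  by apply/permP=> x; rewrite affineE perm1 addr0 mul1r.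
suff -> : dilation g * translation a * (dilation h * translation b) =
          dilation (g * h) * translation (val h * a + b)%R.
  by apply: imset2_f; rewrite ?groupM ?inE.
apply/permP=> x; rewrite permM !affineE /= mulrDr addrA mulrA.
by congr (_ * _ + _ + _)%R; rewrite mulrC.
Qed.

Canonical affine_group H := Group (@affine_group_set H).

Lemma affine_sdprod (H : {group {unit 'Z_p}}) :
  translations ><| dilations H = affine H.
Proof.
have nTD : dilations H \subset 'N(translations).
  apply/subsetP=> _ /imsetP[h _ ->]; rewrite inE.
  apply/subsetP=> _ /imsetP[_ /imsetP[a _ ->] ->].
  apply/imsetP; exists (val h * a)%R => //.
  apply: (mulgI (dilation h)); rewrite conjgE !mulgA mulgV mul1g.
  by apply/permP=> x; rewrite affineE !permM !permE /= mulrDr.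
have tiTD : translations :&: dilations H = 1.
  apply/trivgP/subsetP=> _ /setIP[/imsetP[a _ ->] /imsetP[h _ E]].
  have := congr1 (fun f : {perm 'Z_p} => f 0%R) E.
  rewrite !permE /= add0r mulr0 => ->.
  by rewrite inE; apply/eqP/permP=> x; rewrite perm1 permE addr0.
rewrite sdprodE // -(normC nTD).
apply/setP=> f; apply/imset2P/imset2P.
  by case=> _ _ /imsetP[h Hh ->] /imsetP[a _ ->] ->; exists h a.
case=> h a Hh _ ->; exists (dilation h) (translation a) => //.
  exact: imset_f.
exact: imset_f.
Qed.

End Affine.

Section Swap.

Variable gT : finGroupType.

Definition swap (x : gT * gT) (z : 'Z_2) : gT * gT :=
  if z == 0%R then x else (x.2, x.1).

Lemma swap1 : swap^~ 1 =1 id.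
Proof. by []. Qed.

Lemma swapM : forall x, act_morph swap x.
Proof. by move=> [x y] [[|[|//]] ?] [[|[|//]] ?]. Qed.

Canonical swap_action := TotalAction swap1 swapM.

Lemma swap_is_groupAction : is_groupAction [set: gT * gT] swap_action.
Proof.
move=> z _; rewrite inE; apply/andP; split.
  by apply/subsetP=> x _; rewrite inE.
apply/morphicP=> [[x1 x2] [y1 y2] _ _]; rewrite !actpermE /= /swap.
by case: (z == 0%R).
Qed.

Canonical swap_groupAction := GroupAction swap_is_groupAction.

End Swap.

(* A [groupAction] has to be trivial outside of its range, so the swap is
   defined on a whole type of pairs, here taken over the subgroup type of A. *)
Definition wreath_Z2 (gT : finGroupType) (A : {group gT}) : finGroupType :=
  sdprod_by (swap_groupAction (subg_of A)).

(* Main.v *)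
Require Import Defs.
From mathcomp Require Import all_boot all_algebra all_fingroup all_solvable.
From mathcomp Require Import all_field.
From mathcomp Require Import zify.

Set Implicit Arguments.
Unset Strict Implicit.
Unset Printing Implicit Defensive.

Import GRing.Theory.

(** The rotations form a subgroup of index two, and the connection set consists
    of rotations.  Hence the Cayley graph has no edge between the two right
    cosets of that subgroup, and each coset carries a copy of the circulant
    graph on Z_p with connection set T ([cayley_pm_powers_isog]).  As T contains
    a generator of Z_p, the circulant graph is connected; an automorphism of the
    disjoint union of two copies of a connected graph either preserves or swaps
    the copies, and acts on them by two independent automorphisms, so that the
    automorphism group is a wreath product with Z_2 ([two_copies_isog]).

    It remains to see that every automorphism f of the circulant graph is of the
    form x |-> h x + b with h = 1 or h = -1 ([circulant_aut]).  That f is affine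
    is an instance of Burnside's theorem on permutation groups of prime degree,
    in the form of a lemma of P. Mueller: a permutation f of F_p that preserves
    the relation x - y \in U, where U is neither empty nor all of F_p^*, is
    affine ([difference_preserving_affine]).  Let w_m be the sum of the m-th
    powers of the elements of U, and r > 0 minimal with w_r <> 0.  Replacing U
    by its complement in F_p^* if necessary, r <= #|U| < p / 2.  For a polynomial
    g of degree less than p, Taylor's formula shows that
        \sum_(u in U) g(x + u) - #|U| g(x)
    has degree exactly deg g - r if deg g >= r, so that it vanishes only when
    deg g < r ([size_shift_sum]).  Now u |-> f(x + u) - f(x) permutes U.  If r = 1,
    then for g = f the expression is the constant w_1, and f has degree 1.  If
    r > 1 and 0 < m < r, then the expression vanishes when g is the polynomial
    of the function f ^ m, which therefore has degree less than r; in particular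
    f has degree n < r.  If n >= 2, there is some m < r with r <= n m < r + n < p,
    and the degree n m of f ^ m contradicts this.

    Finally, when h T = T, the bound on p makes the multiplication by h visible
    in the integers: h = h * 1 is congruent to c or -c for some c among
    1, t_1, ..., and c M is congruent to d or -d for some d in the same list,
    where M is the largest entry.  Since c M + M < p this forces c M = d <= M,
    hence c = 1 ([pm_residues_stable_unit]). *)

(** * Polynomials and power sums over a finite field *)

Section FiniteField.

Local Open Scope ring_scope.

Variable F : finFieldType.

Lemma poly_of_fun (f : F -> F) :
  exists2 P : {poly F}, (size P <= #|F|)%N & forall x, P.[x] = f x.
Proof.
have F_gt0 : (0 < #|F|)%N by apply/card_gt0P; exists 0.
(* 1 - (X - a)^(q - 1) is the indicator function of a, by Fermat. *)
pose ind (a : F) : {poly F} := 1 - ('X - a%:P) ^+ #|F|.-1.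
exists (\sum_a f a *: ind a) => [|x].
  apply: (leq_trans (size_sum _ _ _)); apply/bigmax_leqP => a _.
  apply: (leq_trans (size_scale_leq _ _)); apply: (leq_trans (size_polyD _ _)).
  rewrite size_polyN geq_max size_poly1 F_gt0 /=.
  apply: (leq_trans (size_poly_exp_leq _ _)).
  by rewrite size_XsubC mul1n prednK.
rewrite horner_sum (bigD1 x) //= !hornerE subrr expr0n.
have F_gt1 : (1 < #|F|)%N.
  by rewrite (cardD1 0) (cardD1 1) !inE oner_neq0.
rewrite -subn1 subn_eq0 leqNgt F_gt1 subr0 mulr1 big1 ?addr0 // => a ax.
rewrite !hornerE.
have xa : x - a != 0 by rewrite subr_eq0 eq_sym.
have -> : (x - a) ^+ #|F|.-1 = 1; last by rewrite subrr mulr0.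
by apply: (mulfI xa); rewrite -exprS prednK // mulr1 expf_card.
Qed.

Definition power_sum (U : {set F}) m : F := \sum_(u in U) u ^+ m.

Lemma power_sum0 U : power_sum U 0 = #|U|%:R.
Proof. by rewrite /power_sum sumr_const. Qed.

(** Summing over U the values of the monic polynomial whose roots are the elements
    of U gives a linear relation between the power sums of orders 0, ..., #|U|, in
    which the power sum of order 0 is #|U| and has a nonzero coefficient. *)
Lemma exists_power_sum_neq0 (U : {set F}) :
    0 \notin U -> #|U|%:R != 0 :> F ->
  exists m, [&& 0 < m, m <= #|U| & power_sum U m != 0%R]%N.
Proof.
move=> U0 cardU.
pose P := \prod_(u <- enum U) ('X - u%:P).
have sizeP : size P = #|U|.+1 by rewrite size_prod_XsubC -cardE.
have P0 : P`_0 != 0.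
  by rewrite -horner_coef0 -[_ == 0]/(root P 0) root_prod_XsubC mem_enum.
have : \sum_(i < #|U|.+1) P`_i * power_sum U i = 0.
  rewrite -sizeP; under eq_bigr do rewrite mulr_sumr.
  rewrite exchange_big big1 //= => u Uu.
  by rewrite -horner_coef; apply/rootP; rewrite root_prod_XsubC mem_enum.
rewrite big_ord_recl /= power_sum0 => sumP.
have [m m_neq0] : exists m : 'I_#|U|, power_sum U m.+1 != 0.
  apply/existsP; apply: contraR (mulf_neq0 P0 cardU).
  rewrite negb_exists => /forallP w0.
  move/eqP: sumP; rewrite big1 ?addr0 // => i _.
  by have /negPn/eqP := w0 i; rewrite /bump /= => ->; rewrite mulr0.
by exists m.+1; rewrite ltn_ord m_neq0.
Qed.

End FiniteField.

(** * Difference-preserving permutations of a prime field *)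

Section PrimeField.

Local Open Scope ring_scope.

Variable p : nat.
Hypothesis p_pr : prime p.

Lemma natr_Fp_neq0 n : (0 < n < p)%N -> n%:R != 0 :> 'F_p.
Proof.
move=> /andP[n0 np]; rewrite -(dvdn_pcharf (pchar_Fp p_pr)).
by apply/negP => /(dvdn_leq n0); rewrite leqNgt np.
Qed.

Lemma bin_Fp_neq0 n m : (m <= n < p)%N -> 'C(n, m)%:R != 0 :> 'F_p.
Proof.
move=> /andP[mn np]; rewrite -(dvdn_pcharf (pchar_Fp p_pr)).
apply/negP => /(dvdn_mulr (m`! * (n - m)`!)); rewrite bin_fact // => pn.
suff : (p <= n)%N by rewrite leqNgt np.
elim: n pn {mn np} => [|n IHn]; first by rewrite dvdn1; case: p p_pr => [|[]].
rewrite factS Euclid_dvdM // => /orP[/dvdn_leq -> //|/IHn /leqW //].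
Qed.

(** The operator g |-> \sum_(u in U) g(X + u) - #|U| g is a combination of the
    divided derivatives g^`N(i) with coefficients the power sums of U, so it lowers
    a degree of at least r by exactly r: the new leading coefficient is that of g times
    'C(deg g, r) w_r, and the binomial is nonzero mod p since deg g < p. *)
Lemma size_shift_sum (U : {set 'F_p}) (r : nat) (g : {poly 'F_p}) (c : 'F_p) :
    (0 < r)%N -> (forall m, (0 < m < r)%N -> power_sum U m = 0) ->
    power_sum U r != 0 -> (size g <= p)%N ->
    (forall x, \sum_(u in U) g.[x + u] = #|U|%:R * g.[x] + c) ->
  (size g <= r + (c != 0%R))%N.
Proof.
move=> r_gt0 w0 wr g_le_p gU; rewrite leqNgt; apply/negP => g_gt.
have rg : (r < size g)%N by apply: leq_trans g_gt; rewrite ltnS leq_addr.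
(* The hypothesis on the values of g makes every element of 'F_p a root of h. *)
pose h := \sum_(0 <= i < (size g).-1) power_sum U i.+1 *: g^`N(i.+1) - c%:P.
have gE x : \sum_(u in U) g.[x + u] =
    \sum_(0 <= i < size g) power_sum U i * g^`N(i).[x].
  rewrite big_mkord.
  under eq_bigr => u _ do rewrite (nderiv_taylor g (mulrC x u)).
  rewrite exchange_big; apply: eq_bigr => i _.
  by rewrite mulr_suml; apply: eq_bigr => u _; rewrite mulrC.
have h0 : h = 0.
  apply: (@roots_geq_poly_eq0 _ _ (enum 'F_p)); rewrite ?enum_uniq //.
    apply/allP => x _; rewrite /root /h hornerD hornerN hornerC horner_sum.
    have := gU x; rewrite gE big_ltn ?(leq_trans _ rg) // power_sum0.
    rewrite big_add1 nderivn0 => /addrI H.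
    by under eq_bigr do rewrite hornerZ; rewrite H subrr.
  rewrite -cardE card_Fp //; apply: leq_trans (size_polyD _ _) _.
  rewrite size_polyN geq_max (leq_trans (size_polyC_leq1 _)) ?prime_gt0 // andbT.
  rewrite big_mkord; apply: leq_trans (size_sum _ _ _) _.
  apply/bigmax_leqP => i _.
  apply: leq_trans (size_scale_leq _ _) (leq_trans _ g_le_p).
  apply/leq_sizeP => j gj; rewrite coef_nderivn nth_default ?mul0rn //.
  exact: leq_trans gj (leq_addl _ _).
(* The coefficient of degree d = deg g - r of h involves the top coefficient of g
   alone: lower power sums vanish, and higher derivatives have lower degree. *)
have [d size_g] : exists d, size g = (r + d).+1.
  by exists ((size g).-1 - r)%N; rewrite subnKC; case: (size g) rg.
have : h`_d = 0 by rewrite h0 coef0.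
rewrite coefB coefC coef_sum size_g /=.
rewrite (bigD1_seq r.-1) ?iota_uniq //=; last first.
  by rewrite mem_index_iota ltn_addr ?prednK.
rewrite big1_seq ?addr0; last first.
  move=> i /andP[ir]; rewrite mem_index_iota => /andP[_ ig].
  rewrite coefZ coef_nderivn.
  have [ltir|leri] := ltnP i.+1 r; first by rewrite w0 ?mul0r // ltir.
  by rewrite [g`__]nth_default ?mul0rn ?mulr0 // size_g; lia.
rewrite coefZ coef_nderivn prednK //.
have -> : (if d == 0%N then c else 0) = 0.
  case: (d =P 0%N) size_g => // -> size_g; apply/eqP; apply: contraTT g_gt => ->.
  by rewrite size_g addn0 addn1 ltnn.
move/eqP; rewrite subr0 mulf_eq0 (negPf wr) /= -mulr_natr mulf_eq0.
rewrite (negPf (bin_Fp_neq0 _)) ?orbF; last first.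
  by rewrite leq_addr -size_g.
have -> : g`_(r + d) = lead_coef g by rewrite /lead_coef size_g.
by rewrite lead_coef_eq0 -size_poly_eq0 size_g.
Qed.

(** Mueller's argument.  The smallness of U leaves enough room below p for a power
    of f whose degree is at least r although its exponent is less than r. *)
Lemma small_difference_preserving_affine (U : {set 'F_p}) (f : 'F_p -> 'F_p) :
    injective f -> U != set0 -> 0 \notin U -> (2 * #|U| < p)%N ->
    (forall x y, x - y \in U -> f x - f y \in U) ->
  exists a b, forall x, f x = a * x + b.
Proof.
move=> f_inj; rewrite -card_gt0 => cardU U0 U_small fU.
have U_lt_p : (#|U| < p)%N by lia.
have r_ex := exists_power_sum_neq0 U0 (natr_Fp_neq0 (introT andP (conj cardU U_lt_p))).
case: (ex_minnP r_ex) => r /and3P[r_gt0 r_le wr] r_min {r_ex}.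
have w0 m : (0 < m < r)%N -> power_sum U m = 0.
  case/andP=> m_gt0 mr; apply/eqP; apply: contraLR mr => wm.
  rewrite -leqNgt; have [mU|Um] := leqP m #|U|.
    by rewrite r_min ?m_gt0 ?mU.
  exact: leq_trans r_le (ltnW Um).
(* u |-> f (x + u) - f x is a permutation of U. *)
have shift m x : \sum_(u in U) f (x + u) ^+ m = \sum_(v in U) (f x + v) ^+ m.
  pose h u := f (x + u) - f x.
  have h_inj : injective h by move=> u v /addIr/f_inj/addrI.
  have {2}<- : h @: U = U.
    apply/eqP; rewrite eqEcard card_imset // leqnn andbT.
    apply/subsetP => _ /imsetP[u Uu ->]; apply: fU.
    by rewrite addrC addKr.
  rewrite big_imset; last by move=> ? ? _ _ /h_inj.
  by apply: eq_bigr => u _; congr (_ ^+ _); exact: esym (subrKC _ _).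
have [P sizeP Pf] := poly_of_fun f; rewrite card_Fp // in sizeP.
suff : (size P <= 2)%N.
  move=> sP; exists P`_1, P`_0 => x.
  rewrite -Pf (horner_coef_wide x sP) big_ord_recl big_ord1 expr0 expr1 mulr1.
  by rewrite addrC.
have [r1|r_neq1] := eqVneq r 1%N.
  have /leq_trans : (size P <= 1 + (power_sum U 1 != 0%R))%N.
    rewrite r1 in w0 wr; apply: (size_shift_sum _ w0) => // x.
    under eq_bigr do rewrite Pf -[f _]expr1.
    rewrite shift Pf; under eq_bigr do rewrite expr1.
    rewrite big_split /= sumr_const mulr_natl; congr (_ + _).
  by apply; case: (_ != _).
have size_pow m : (m < r)%N -> (size (P ^+ m) <= p)%N -> (size (P ^+ m) <= r)%N.
  move=> mr Pm; have := @size_shift_sum U r (P ^+ m) 0 r_gt0 w0 wr Pm.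
  rewrite eqxx addn0; apply=> x.
  rewrite addr0; under eq_bigr do rewrite horner_exp Pf.
  rewrite shift horner_exp Pf; under eq_bigr do rewrite exprDn.
  rewrite exchange_big big_ord_recl /= subn0 [X in _ + X]big1 ?addr0 => [|i _].
    rewrite bin0 (eq_bigr (fun=> f x ^+ m)) ?sumr_const ?mulr_natl //.
    by move=> u _; rewrite mulr1.
  rewrite sumrMnl -mulr_sumr [X in _ * X](w0 i.+1) ?mulr0 ?mul0rn //.
  exact: leq_ltn_trans (ltn_ord i) mr.
rewrite leqNgt; apply/negP => P_gt2.
(* m is the least exponent with r <= n * m. *)
pose n := (size P).-1; pose m := ((r.-1) %/ n).+1.
have n_ge2 : (2 <= n)%N by rewrite /n; case: (size P) P_gt2.
have r_ge2 : (2 <= r)%N by rewrite ltn_neqAle eq_sym r_neq1.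
have P_ler : (size P <= r)%N by have := size_pow 1%N r_ge2; rewrite expr1; apply.
have sizePm : size (P ^+ m) = (n * m).+1.
  rewrite -size_exp prednK // size_poly_gt0 expf_neq0 //.
  by rewrite -size_poly_gt0 (leq_trans _ P_gt2).
have nP : (n < r)%N by rewrite /n; case: (size P) P_gt2 P_ler.
have nm_gt : (r <= n * m)%N.
  by rewrite -(prednK r_gt0) mulnC ltn_ceil // (leq_trans _ n_ge2).
have nm_lt : (n * m <= r.-1 + n)%N.
  by rewrite mulnS addnC leq_add2r mulnC leq_divM.
have mr : (m < r)%N.
  rewrite -(ltn_pmul2l (leq_trans _ n_ge2)) //; apply: leq_ltn_trans nm_lt _.
  by move: nP n_ge2 r_ge2; clearbody n; clear; nia.
have r2p : (2 * r < p)%N by apply: leq_ltn_trans U_small; rewrite leq_mul2l.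
have : (n * m < p)%N by move: nm_lt nP r2p; clearbody n m; clear; lia.
by rewrite -sizePm => /(size_pow m mr); rewrite sizePm ltnNge nm_gt.
Qed.

(** An injection preserving membership of differences in U also preserves their
    membership in the complement of U in F_p^*, and one of these two sets has less
    than p / 2 elements. *)
Lemma difference_preserving_affine (U : {set 'F_p}) (f : 'F_p -> 'F_p) :
    injective f -> U != set0 -> 0 \notin U ->
    (exists2 y, y != 0 & y \notin U) ->
    (forall x y, (f x - f y \in U) = (x - y \in U)) ->
  exists a b, forall x, f x = a * x + b.
Proof.
move=> f_inj Un0 U0 [y y0 yU] fU.
have [small|large] := ltnP (2 * #|U|) p.
  by apply: (@small_difference_preserving_affine U) => // x z; rewrite fU.
pose W : {set 'F_p} := [set x | (x != 0) && (x \notin U)].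
apply: (@small_difference_preserving_affine W) => //.
- by apply/set0Pn; exists y; rewrite inE y0.
- by rewrite inE eqxx.
- have : (#|U| + #|W| < p)%N.
    rewrite -[X in (_ < X)%N](card_Fp p_pr) -cardsUI.
    have -> : U :&: W = set0.
      by apply/setP => x; rewrite !inE; case: (x \in U); rewrite ?andbF.
    rewrite cards0 addn0 -cardsT; apply/proper_card/properP.
    by split; [exact: subsetT|exists 0; rewrite ?inE // eqxx orbF].
  by move: large; move: #|_| #|_|; clear; lia.
- by move=> x z; rewrite !inE !subr_eq0 (inj_eq f_inj) fU.
Qed.

(** The field structure lives on 'F_p = 'Z_(pdiv p), which for a prime p equals
    'Z_p but is not convertible to it. *)
Lemma Zp_difference_preserving_affine (U : {set 'Z_p}) (f : 'Z_p -> 'Z_p) :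
    injective f -> U != set0 -> 0 \notin U ->
    (exists2 y, y != 0 & y \notin U) ->
    (forall x y, (f x - f y \in U) = (x - y \in U)) ->
  exists a b, forall x, f x = a * x + b.
Proof.
suff transfer q : q = pdiv p -> forall (V : {set 'Z_q}) (g : 'Z_q -> 'Z_q),
    injective g -> V != set0 -> 0 \notin V ->
    (exists2 y, y != 0 & y \notin V) ->
    (forall x y, (g x - g y \in V) = (x - y \in V)) ->
    exists a b, forall x, g x = a * x + b.
  exact: transfer (esym (pdiv_id p_pr)) U f.
by move=> -> V g; apply: difference_preserving_affine.
Qed.

End PrimeField.

(** * Circulant graphs with small connection sets *)

Section Circulant.

Local Open Scope ring_scope.

Variable p : nat.

Definition circulant (T : {set 'Z_p}) : rel 'Z_p := fun x y => x - y \in T.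

(** Each x is adjacent to x + 1, and 1 generates Z_p. *)
Lemma circulant_connect (T : {set 'Z_p}) :
  -1 \in T -> forall x y, connect (circulant T) x y.
Proof.
move=> T1 x y; rewrite -(subrKC x y) -(natr_Zp (y - x)).
elim: (nat_of_ord _) => [|n IHn]; first by rewrite addr0.
apply: connect_trans IHn (connect1 _).
by rewrite /circulant mulrSr addrA opprD addrA subrr add0r.
Qed.

Definition pm_residues (ts : seq nat) : {set 'Z_p} :=
  [set x in [seq a%:R | a <- ts] ++ [seq - a%:R | a <- ts]].

Lemma pm_residuesP ts (x : 'Z_p) :
  reflect (exists2 a, a \in ts & x = a%:R \/ x = - a%:R) (x \in pm_residues ts).
Proof.
rewrite inE mem_cat; apply: (iffP orP) => [[]/mapP[a ta ->]|[a ta [->|->]]].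
- by exists a; [|left].
- by exists a; [|right].
- by left; apply: map_f.
- by right; apply: (map_f (fun b => - b%:R)).
Qed.

Lemma pm_residuesN ts (x : 'Z_p) :
  (- x \in pm_residues ts) = (x \in pm_residues ts).
Proof.
apply/pm_residuesP/pm_residuesP => -[a ta ax]; exists a => //.
  by case: ax => [/eqP|/oppr_inj->]; [rewrite eqr_oppLR => /eqP|]; auto.
by case: ax => ->; rewrite ?opprK; auto.
Qed.

Lemma natr_Zp_eq0 n : (1 < p)%N -> (n%:R == 0 :> 'Z_p) = (p %| n)%N.
Proof. by move=> p_gt1; rewrite -val_eqE /= val_Zp_nat. Qed.

Lemma maxM_mem ts : ts != [::] -> maxM ts \in ts.
Proof.
case: ts => // a ts _; rewrite /maxM.
elim: ts a => [|b ts IHts] a; first by rewrite big_seq1 mem_head.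
rewrite big_cons; case: leqP => _; first by rewrite inE IHts orbT.
exact: mem_head.
Qed.

Lemma leq_maxM ts a : a \in ts -> (a <= maxM ts)%N.
Proof. by move=> ta; apply: leq_bigmax_seq. Qed.

Lemma leq_maxQ ts a b : a \in ts -> b \in ts -> (a * b + maxM ts <= maxQ ts)%N.
Proof.
move=> ta tb; rewrite /maxQ.
apply: (@leq_trans (\max_(c <- ts) (a * c + maxM ts))%N).
  by apply: (@leq_bigmax_seq _ _ _ (fun c => (a * c + maxM ts)%N)).
by apply: (@leq_bigmax_seq _ _ _ (fun a => \max_(c <- ts) (a * c + maxM ts)%N)).
Qed.

Variable ts : seq nat.
Hypotheses (p_pr : prime p) (p_gtQ : (maxQ ts < p)%N).
Hypotheses (ts_gt0 : forall a, a \in ts -> (0 < a)%N) (ts1 : 1%N \in ts).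

Local Notation M := (maxM ts).
Local Notation T := (pm_residues ts).

Let p_gt1 : (1 < p)%N := prime_gt1 p_pr.

Let M_in : M \in ts.
Proof. by apply: maxM_mem; case: ts ts1. Qed.

Let M_gt0 : (0 < M)%N := ts_gt0 M_in.

Let M2p : (M * M + M < p)%N.
Proof. exact: leq_ltn_trans (leq_maxQ M_in M_in) p_gtQ. Qed.

(** For a in the list, both n - a and n + a are less than p in absolute value, so
    a congruence between n and a or -a is an equality of integers. *)
Lemma natr_pm_residues n : (0 < n)%N -> (n + M < p)%N ->
  (n%:R \in T) = (n \in ts).
Proof.
move=> n_gt0 np; apply/pm_residuesP/idP => [[a ta]|tn]; last by exists n; auto.
have aM := leq_maxM ta; have a_gt0 := ts_gt0 ta.
case=> [/(congr1 val)|/eqP].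
  by rewrite /= !val_Zp_nat // !modn_small ?(leq_ltn_trans _ np) ?leq_addr //;
    [move=> -> | rewrite (leq_trans aM) ?leq_addl].
rewrite -subr_eq0 opprK -natrD natr_Zp_eq0 // => /dvdn_leq; lia.
Qed.

(** The image of 1 gives a = c or a = -c with c in the list, and the image of the
    largest entry M then puts c * M in the list, whence c = 1. *)
Lemma pm_residues_stable_unit (a : 'Z_p) :
  (forall x, x \in T -> a * x \in T) -> a = 1 \/ a = -1.
Proof.
move=> aT.
have /aT : 1 \in T by rewrite -[1]/(1%:R) natr_pm_residues //; nia.
rewrite mulr1 => /pm_residuesP[c tc ac].
have c_gt0 := ts_gt0 tc.
have cM : (c%:R * M%:R : 'Z_p) \in T.
  have : a * M%:R \in T by apply: aT; apply/pm_residuesP; exists M; auto.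
  by case: ac => ->; rewrite ?mulNr ?pm_residuesN.
rewrite -natrM natr_pm_residues in cM; first last.
- exact: leq_ltn_trans (leq_maxQ tc M_in) p_gtQ.
- by rewrite muln_gt0 c_gt0 ts_gt0.
suff c1 : c = 1%N by rewrite c1 in ac.
have := leq_maxM cM; nia.
Qed.

(** The residue of M + 1 witnesses that T is not all of Z_p^*; this is where M > 1
    enters, through M + 1 + M < p. *)
Lemma circulant_aut (u : {unit 'Z_p}) (u_val : val u = -1) (M_gt1 : (1 < M)%N) :
  graph_aut (circulant T) = affine <[u]>%g.
Proof.
apply/setP => f; apply/graph_autP/imset2P; last first.
  case=> _ b /cycleP[i ->] _ -> x y; rewrite /circulant !affineE.
  rewrite opprD addrACA subrr addr0 -mulrBr FinRing.val_unitX u_val.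
  rewrite -signr_odd.
  by case: odd; rewrite ?expr0 ?expr1 ?mulN1r ?mul1r ?pm_residuesN.
move=> fT.
have [|||||a [b fE]] := @Zp_difference_preserving_affine p p_pr T f.
- exact: perm_inj.
- by apply/set0Pn; exists 1; rewrite -[1]/(1%:R) natr_pm_residues //; nia.
- apply/negP => /pm_residuesP[a ta a0]; have := ts_gt0 ta; have := leq_maxM ta.
  suff /dvdn_leq : (p %| a)%N by nia.
  rewrite -natr_Zp_eq0 //; case: a0 => [<- //|/eqP].
  by rewrite eq_sym oppr_eq0.
- exists (M.+1)%:R; last first.
    by rewrite natr_pm_residues ?(contraNN (@leq_maxM _ _)) ?ltnn //; nia.
  rewrite natr_Zp_eq0 //; apply/negP => /dvdn_leq; nia.
- exact: fT.
have a_pm : a = 1 \/ a = -1.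
  apply: pm_residues_stable_unit => x Tx.
  by have := fT x 0; rewrite /circulant !fE mulr0 add0r addrK subr0 Tx.
have fE' (h : {unit 'Z_p}) : val h = a -> f = (dilation h * translation b)%g.
  by move=> ha; apply/permP => x; rewrite affineE fE ha.
case: a_pm => a_val.
  by exists 1%g b; rewrite ?group1 ?inE //; apply: fE'.
by exists u b; rewrite ?cycle_id ?inE //; apply: fE'; rewrite u_val.
Qed.

End Circulant.

(** * Automorphisms of two copies of a connected graph *)

Section GraphIsomorphism.

Local Open Scope group_scope.

Variables (V W : finType) (e : rel V) (d : rel W) (h : V -> W) (k : W -> V).
Hypotheses (hK : cancel h k) (kH : cancel k h).
Hypothesis h_edge : forall x y, d (h x) (h y) = e x y.

Lemma conj_perm_inj (f : {perm V}) : injective (h \o f \o k).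
Proof. exact: inj_comp (inj_comp (can_inj hK) perm_inj) (can_inj kH). Qed.

Definition conj_perm f := perm (@conj_perm_inj f).

Lemma conj_permM : {in graph_aut e &, {morph conj_perm : f g / f * g}}.
Proof. by move=> f g _ _; apply/permP => x; rewrite !(permE, permM) /= hK permM. Qed.

Canonical conj_perm_morphism := Morphism conj_permM.

Lemma graph_iso_isog : graph_aut e \isog graph_aut d.
Proof.
apply: (isom_isog conj_perm_morphism) => //; apply/isomP; split.
  apply/injmP => f g _ _ /permP fg; apply/permP => x; apply: (can_inj hK).
  by have := fg (h x); rewrite !permE /= hK.
apply/setP => g; rewrite morphimEdom; apply/imsetP/idP => [[f /graph_autP fe ->]|].
  by apply/graph_autP => x y; rewrite !permE /= h_edge fe -h_edge !kH.
move=> /graph_autP gd.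
have f_inj : injective (k \o g \o h).
  exact: inj_comp (inj_comp (can_inj kH) perm_inj) (can_inj hK).
exists (perm f_inj).
  by apply/graph_autP => x y; rewrite !permE /= -h_edge !kH gd h_edge.
by apply/permP => x; rewrite !permE /= permE /= !kH.
Qed.

End GraphIsomorphism.

Section TwoCopies.

Local Open Scope group_scope.

Variables (V : finType) (e : rel V).

Definition two_copies : rel (V * 'Z_2) := fun x y => (x.2 == y.2) && e x.1 y.1.

Definition fiber T (ab : T * T) (z : 'Z_2) : T := if z == 0%R then ab.1 else ab.2.

Local Notation A := (graph_aut_group e).
Local Notation W := (wreath_Z2 A).

Lemma fiber_swap (gT : finGroupType) (x : gT * gT) (z y : 'Z_2) :
  fiber (swap x z) y = fiber x (y + z)%R.
Proof. by case: z y => [[|[|//]] ?] [[|[|//]] ?]. Qed.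

Lemma fiberM (gT : finGroupType) (a b : gT * gT) z :
  fiber (a * b) z = fiber a z * fiber b z.
Proof. by rewrite /fiber; case: ifP. Qed.

(** In [wreath_Z2] the pair (z, ab) stands for the product of z and ab, and
    permutations compose from left to right: so the copies are first permuted by z,
    and the component of ab at the new copy is then applied. *)
Definition wreath_map (w : W) (x : V * 'Z_2) : V * 'Z_2 :=
  let z := (x.2 + (val w).1)%R in (sgval (fiber (val w).2 z) x.1, z).

Lemma wreath_map_inj w : injective (wreath_map w).
Proof.
move=> [x y] [x' y'] E; have := addIr _ (congr1 snd E) => /= yy'.
by move: (congr1 fst E); rewrite /= yy' => /perm_inj ->.
Qed.

Definition wreath_perm w := perm (@wreath_map_inj w).

Lemma Z2_addK (x y : 'Z_2) : (x + y + y = x)%R.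
Proof. by case: x y => [[|[|//]] ?] [[|[|//]] ?]; apply: val_inj. Qed.

Lemma wreath_permM : {in [set: W] &, {morph wreath_perm : v w / v * w}}.
Proof.
move=> v w _ _; apply/permP => -[x y]; rewrite permM !permE /wreath_map.
have -> : (val (v * w)).1 = ((val v).1 + (val w).1)%R by [].
have -> : (val (v * w)).2 = swap (val v).2 (val w).1 * (val w).2 by [].
by rewrite /= addrA fiberM fiber_swap Z2_addK permM.
Qed.

Canonical wreath_perm_morphism := Morphism wreath_permM.

Hypothesis e_conn : forall x y, connect e x y.
Variable x0 : V.

(** An edge stays in one copy, and so does its image; by connectedness the image of
    a whole copy lies in one copy. *)
Lemma two_copies_swap_or_fix (g : {perm V * 'Z_2}) :
  g \in graph_aut two_copies -> exists z, forall x y, (g (x, y)).2 = (y + z)%R.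
Proof.
move=> /graph_autP gE.
have g2 x y : (g (x, y)).2 = (g (x0, y)).2.
  case/connectP: (e_conn x0 x) => s + ->.
  elim: s x0 => //= b s IHs a /andP[ab /IHs->].
  by have := gE (a, y) (b, y); rewrite /two_copies /= eqxx ab => /andP[/eqP].
exists (g (x0, 0%R)).2 => x y; rewrite g2.
(* Otherwise g would map everything into one copy. *)
have neq : (g (x0, 0%R)).2 != (g (x0, 1%R)).2.
  apply/eqP => E.
  have all2 v : (g v).2 = (g (x0, 0%R)).2.
    case: v => v [[|[|//]] ?]; rewrite g2; last rewrite E;
      by congr (g (_, _)).2; apply: val_inj.
  have := all2 (g^-1 (x0, (g (x0, 0%R)).2 + 1)%R); rewrite permKV /=.
  by move/(congr1 val); case: (g _).2 => [[|[|//]] ?].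
have [->|y_neq0] := eqVneq y 0%R; first by rewrite add0r.
have -> : y = 1%R by case: y y_neq0 => [[|[|//]] ?] //= _; apply: val_inj.
case: (g _).2 (g _).2 neq => [[|[|//]] ?] [[|[|//]] ?] // _; exact: val_inj.
Qed.

(** An automorphism is determined by the permutation z of the copies and by the maps
    that it induces from copy to copy, each of which is an automorphism of e. *)
Lemma two_copies_isog : graph_aut two_copies \isog [set: W].
Proof.
rewrite isog_sym; apply: (isom_isog wreath_perm_morphism) => //; apply/isomP; split.
  apply/injmP => v w _ _ /permP vw.
  have z_eq : (val v).1 = (val w).1.
    by have := vw (x0, 0%R); rewrite !permE => /(congr1 snd) E; exact: addrI E.
  have ab_eq z : fiber (val v).2 z = fiber (val w).2 z.
    apply: val_inj; apply/permP => x.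
    have := vw (x, z + (val v).1)%R; rewrite !permE => /(congr1 fst).
    by rewrite /wreath_map -z_eq [fst (_, _)]/= Z2_addK.
  apply: val_inj; move: z_eq (ab_eq 0%R) (ab_eq 1%R); rewrite /fiber /=.
  by case: (val v) (val w) => [? [? ?]] [? [? ?]] /= -> -> ->.
apply/setP => g; rewrite morphimEdom; apply/imsetP/idP => [[w _ ->]|].
  apply/graph_autP => -[x y] [x' y']; rewrite !permE /two_copies /wreath_map /=.
  rewrite (inj_eq (addIr _)); case: eqP => //= ->.
  by have /graph_autP -> := valP (fiber (val w).2 (y' + (val w).1)%R).
move=> gA; have [z gz] := two_copies_swap_or_fix gA.
pose gc y x := (g (x, y)).1.
have gE x y : g (x, y) = (gc y x, y + z)%R by rewrite -(gz x) -surjective_pairing.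
have gc_inj y : injective (gc y).
  by move=> x x' E; have /perm_inj[] : g (x, y) = g (x', y) by rewrite !gE E.
have gcA y : perm (gc_inj y) \in A.
  apply/graph_autP => x x'; rewrite !permE.
  have /graph_autP/(_ (x, y) (x', y)) := gA.
  by rewrite !gE /two_copies /= !eqxx.
(* The copy sent by g to copy number y is copy number y - z. *)
pose ab := (subg A (perm (gc_inj (0 - z)%R)), subg A (perm (gc_inj (1 - z)%R))).
have wP : (z, ab) \in setX [set: 'Z_2] [set: subg_of A * subg_of A].
  by rewrite !inE.
exists (SdPair (swap_groupAction (subg_of A)) wP) => //.
apply/permP => -[x y]; rewrite permE gE /wreath_map /=; congr (_, _).
rewrite (fun_if sgval) !subgK // (fun_if (fun f : {perm V} => f x)) !permE /=.
case: ifP => [|y1]; first by rewrite addr_eq0 sub0r => /eqP->.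
suff -> : y = (1 - z)%R by [].
by case: y z y1 {ab gz gE wP} => [[|[|//]] ?] [[|[|//]] ?] //= _; apply: val_inj.
Qed.

End TwoCopies.

(** * Groups with a cyclic subgroup of index two *)

Section IndexTwoCycle.

Local Open Scope group_scope.

Variables (gT : finGroupType) (p : nat) (r s : gT).
Hypotheses (p_gt1 : (1 < p)%N) (oG : #|gT| = p.*2).
Hypotheses (or : #[r] = p) (rs : s \notin <[r]>).

Lemma expg_Zp n : r ^+ (n%:R : 'Z_p)%R = r ^+ n.
Proof. by rewrite val_Zp_nat // -or expg_mod_order. Qed.

Lemma expgB_Zp (x y : 'Z_p) : r ^+ (x - y)%R = r ^+ x * (r ^+ y)^-1.
Proof.
apply: (mulIg (r ^+ y)); rewrite -mulgA mulVg mulg1 -expgD -[LHS]expg_Zp natrD.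
by rewrite !natr_Zp subrK.
Qed.

Lemma expg_Zp_inj : injective (fun x : 'Z_p => r ^+ x).
Proof.
move=> x y /eqP; rewrite eq_expg_mod_order or => /eqP E; apply: val_inj.
by move: E; rewrite !modn_small // -[X in (_ < X)%N](Zp_cast p_gt1) ltn_ord.
Qed.

(** Rotations are put on the left, because the components of the Cayley graph are
    the right cosets of <[r]>. *)
Definition cycle_coset_elt (u : 'Z_p * 'Z_2) : gT := r ^+ u.1 * s ^+ u.2.

Lemma cycle_coset_elt_div u v :
  cycle_coset_elt u * (cycle_coset_elt v)^-1 \in <[r]> -> u.2 = v.2.
Proof.
case: u v => [x y] [x' y']; rewrite /cycle_coset_elt invMg /=.
rewrite mulgA groupMr ?groupV ?mem_cycle // -mulgA groupMl ?mem_cycle //.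
case: y y' => [[|[|//]] ?] [[|[|//]] ?] /=;
  rewrite ?mul1g ?invg1 ?mulg1 ?groupV ?(negPf rs) // => _; exact: val_inj.
Qed.

Lemma cycle_coset_elt_bij : bijective cycle_coset_elt.
Proof.
apply: inj_card_bij => [u v E|].
  have E2 : u.2 = v.2 by apply: cycle_coset_elt_div; rewrite E mulgV group1.
  case: u v E E2 => [x y] [x' y'] + /= E2; rewrite /cycle_coset_elt /= E2.
  by move=> /mulIg/expg_Zp_inj->.
by rewrite oG card_prod !card_ord Zp_cast // muln2.
Qed.

Lemma pm_powers_Zp ts (x : 'Z_p) :
  (r ^+ x \in pm_powers r ts) = (x \in pm_residues p ts).
Proof.
have rN a : r ^+ (- a%:R : 'Z_p)%R = r ^- a.
  by rewrite -sub0r expgB_Zp expg_Zp expg0 mul1g.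
rewrite !inE !mem_cat; congr (_ || _).
all: rewrite -(mem_map expg_Zp_inj) -map_comp; congr (_ \in _).
all: by apply: eq_map => a; rewrite /= ?rN ?expg_Zp.
Qed.

Lemma pm_powers_sub ts : pm_powers r ts \subset <[r]>.
Proof.
apply/subsetP => x; rewrite inE mem_cat => /orP[]/mapP[a _ ->].
  exact: mem_cycle.
by rewrite groupV mem_cycle.
Qed.

(** The bijection (x, y) |-> r ^ x s ^ y is a graph isomorphism, because
    r ^ x s ^ y (r ^ x' s ^ y')^-1 equals r ^ (x - x') when y = y', and lies outside
    <[r]> otherwise. *)
Lemma cayley_pm_powers_isog ts :
  graph_aut (two_copies (circulant (pm_residues p ts)))
    \isog graph_aut (cayley (pm_powers r ts)).
Proof.
have [k hK kH] := cycle_coset_elt_bij.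
apply: (graph_iso_isog hK kH) => -[x y] [x' y'].
rewrite /two_copies /cayley /circulant /=.
case: eqP => /= [->|yy']; last first.
  by apply/negP => /(subsetP (pm_powers_sub ts))/cycle_coset_elt_div/yy'.
by rewrite /cycle_coset_elt /= invMg mulgA mulgK -expgB_Zp pm_powers_Zp.
Qed.

End IndexTwoCycle.

Theorem theorem3p7 (k : nat) (hk : (2 <= k)%N)
    (t : 'I_k.-1 -> nat) (t_inj : injective t) (t_ge2 : forall i, (2 <= t i)%N)
    (p : nat) (p_prime : prime p) (p_gtQ : (maxQ (one_and t) < p)%N)
    (r s : 'D_(p.*2))
    (rs_gen : (<<[set r; s]>> = [set: 'D_(p.*2)])%g)
    (r_p : (r ^+ p = 1)%g) (s_2 : (s ^+ 2 = 1)%g)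
    (srs : (s * r * s = r^-1)%g)
    (S : {set 'D_(p.*2)}) (S_def : S = pm_powers r (one_and t))
    (S_distinct : #|S| = k.*2) (S_nonid : (1 \notin S)%g)
    (u : {unit 'Z_p}) (u_def : val u = (p.-1)%:R%R) :
  (graph_aut (cayley S) \isog [set: wreath_Z2 (affine_group <[u]>)])%g.
Proof.
have p_gt1 := prime_gt1 p_prime.
have oD : #|'D_(p.*2)| = p.*2 by rewrite -cardsT card_dihedral.
have ts1 : 1%N \in one_and t := mem_head _ _.
have or : #[r]%g = p.
  apply/(prime_nt_dvdP p_prime); last by rewrite order_dvdn r_p.
  rewrite order_eq1; apply: contraNneq S_nonid => r1.
  rewrite S_def inE mem_cat; apply/orP; left.
  by apply/mapP; exists 1%N; rewrite ?r1 ?expg1n.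
have s_notin : s \notin <[r]>%g.
  apply/negP => sr; have : [set: 'D_(p.*2)] \subset <[r]>%g.
    by rewrite -rs_gen gen_subG; apply/subsetP => x /set2P[] ->; rewrite ?cycle_id.
  by move/subset_leq_card; rewrite cardsT oD -orderE or; lia.
have ts_gt0 a : a \in one_and t -> (0 < a)%N.
  by rewrite inE => /orP[/eqP-> //|/mapP[i _ ->]]; apply: ltnW.
have u_val : (val u = -1)%R.
  by apply/eqP; rewrite u_def -addr_eq0 natr1 prednK ?prime_gt0 // natr_Zp_eq0.
have M_gt1 : (1 < maxM (one_and t))%N.
  have k1_gt0 : (0 < k.-1)%N by rewrite -ltnS prednK // ltnW.
  apply: (leq_trans (t_ge2 (Ordinal k1_gt0))); apply: leq_maxM.
  by rewrite inE; apply/orP; right; apply: map_f; rewrite mem_enum.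
rewrite S_def isog_sym.
apply: isog_trans (cayley_pm_powers_isog p_gt1 oD or s_notin _).
rewrite isog_sym.
have -> : affine_group <[u]> =
    graph_aut_group (circulant (pm_residues p (one_and t))).
  by apply/group_inj/esym/circulant_aut.
apply: two_copies_isog 0%R => //; apply: circulant_connect.
by apply/pm_residuesP; exists 1%N; auto.
Qed.
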